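(* Let $\gamma\ge 1$, $\mu,k>0$, $s\in\mathbb{R}$, and let $(R^\pm,U^\pm)$ with $R^\pm>0$ be the end states (at $\pm\infty$) of a traveling wave profile $(R,U)$ with speed $s$ of the quantum hydrodynamics system. For each of the two signs $\pm$ and each $\xi\in\mathbb{R}$ consider the dispersion relation, a quadratic equation in $\lambda\in\mathbb{C}$, $$\lambda^2+\bigl(\mu\xi^2-2i\xi(s-U^\pm)\bigr)\lambda+\bigl(R^\pm h'(R^\pm)-(s-U^\pm)^2\bigr)\xi^2+\frac{k^2}{2}\xi^4-is\mu\xi^3=0,$$ with roots $\lambda_{1,2}=\lambda_{1,2}(\xi)$. If the end states are subsonic or sonic, i.e. $|U^\pm|\le c_s(R^\pm)$, then the curves $\lambda(\xi)$, $\xi\in\mathbb{R}$, solving the dispersion relation lie in the closed left half-plane $\{\Re\lambda\le 0\}$. Moreover, if $\xi\neq 0$, then $\Re\lambda_{1,2}(\xi)<0$.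
   Context: The enthalpy is $h(\rho)=\ln\rho$ if $\gamma=1$ and $h(\rho)=\frac{\gamma}{\gamma-1}\rho^{\gamma-1}$ if $\gamma>1$; thus $h'(\rho)>0$ for $\rho>0$. The sound speed is $c_s(\rho)=\sqrt{\rho h'(\rho)}$. A state $(\rho,u)$ is subsonic if $|u|<c_s(\rho)$ and sonic if $|u|=c_s(\rho)$. A traveling wave profile with speed $s$ is a pair of smooth functions $R>0$, $U$ on $\mathbb{R}$ with limits $R(y)\to R^\pm>0$, $U(y)\to U^\pm$ as $y\to\pm\infty$, satisfying $-sR'+(RU)'=0$ and $-sU'+\bigl(\tfrac{U^2}{2}\bigr)'+(h(R))'=\mu\bigl(\tfrac{(RU)'}{R}\bigr)'+k^2\bigl(\tfrac{(\sqrt R)''}{\sqrt R}\bigr)'$. The dispersion relation only involves the constants $\mu,k,s,\gamma,R^\pm,U^\pm$; its solution curves bound the essential spectrum of the linearization around the profile. *)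

(* Defs.v *)
From Stdlib Require Import Reals.
From Coquelicot Require Import Coquelicot.
Open Scope R_scope.

(** Only [gamma >= 1] and [rho > 0] are meaningful. *)
Definition enthalpy (gamma rho : R) : R :=
  if Req_EM_T gamma 1 then ln rho
  else gamma / (gamma - 1) * Rpower rho (gamma - 1).

Definition sound_speed (gamma rho : R) : R :=
  sqrt (rho * Derive (enthalpy gamma) rho).

Definition subsonic (gamma rho u : R) : Prop :=
  Rabs u < sound_speed gamma rho.

Definition sonic (gamma rho u : R) : Prop :=
  Rabs u = sound_speed gamma rho.

Definition smooth (f : R -> R) : Prop :=
  forall (n : nat) (y : R), ex_derive_n f n y.

(** The two ends of the real line: the superscripts [-] and [+]. *)
Inductive side : Set := Minus | Plus.

Definition side_infty (e : side) : Rbar :=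
  match e with Minus => m_infty | Plus => p_infty end.

(** The profile is the pair [(Rho, U)]; its end states are
    [(Rend Minus, Uend Minus)] and [(Rend Plus, Uend Plus)]. *)
Record traveling_wave_profile (gamma mu k s : R) (Rho U : R -> R)
    (Rend Uend : side -> R) : Prop := {
  profile_density_smooth : smooth Rho;
  profile_velocity_smooth : smooth U;
  profile_density_pos : forall y, 0 < Rho y;
  profile_density_lim : forall e, is_lim Rho (side_infty e) (Rend e);
  profile_velocity_lim : forall e, is_lim U (side_infty e) (Uend e);
  profile_mass : forall y,
    - s * Derive Rho y + Derive (fun z => Rho z * U z) y = 0;
  profile_momentum : forall y,
    - s * Derive U y + Derive (fun z => (U z) ^ 2 / 2) y
      + Derive (fun z => enthalpy gamma (Rho z)) y
    = mu * Derive (fun z => Derive (fun w => Rho w * U w) z / Rho z) y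
      + k ^ 2 * Derive (fun z => Derive_n (fun w => sqrt (Rho w)) 2 z
                                  / sqrt (Rho z)) y
}.

Definition dispersion_relation (gamma mu k s rho u xi : R) (lam : C) : Prop :=
  (lam * lam
   + (RtoC (mu * xi ^ 2) - 2 * Ci * RtoC (xi * (s - u))) * lam
   + RtoC ((rho * Derive (enthalpy gamma) rho - (s - u) ^ 2) * xi ^ 2)
   + RtoC (k ^ 2 / 2 * xi ^ 4)
   - Ci * RtoC (s * mu * xi ^ 3) = 0)%C.

(* Main.v *)
Require Import Defs.
From Stdlib Require Import Reals.
From Coquelicot Require Import Coquelicot.
From Stdlib Require Import Lra Psatz.
Open Scope R_scope.

(** Write [c2 = rho h'(rho)] for the squared sound speed.  In the moving
    variable [sigma = lam - i xi (s - u)] the shift [s] disappears from the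
    dispersion relation, which becomes
    [sigma^2 + mu xi^2 sigma + c2 xi^2 + k^2 xi^4 / 2 = i mu xi^3 u],
    and [Re sigma = Re lam].  Let [sigma = a + i tau].  The imaginary part reads
    [(2 a + mu xi^2) tau = mu xi^2 (xi u)], so if [a >= 0] and [xi <> 0] then
    [|tau| <= |xi u|].  For a subsonic or sonic state [u^2 <= c2], hence
    [tau^2 <= c2 xi^2]; but the real part
    [a^2 + mu xi^2 a + (c2 xi^2 - tau^2) + k^2 xi^4 / 2 = 0] is then a sum of
    nonnegative terms whose last one is positive, which is absurd
    ([Re_neg_of_split_dispersion]).  At [xi = 0] the only root is [0].

    The bound [u^2 <= c2] follows from [|u| <= sqrt c2] only because [c2 >= 0],
    i.e. because the enthalpy is increasing ([enthalpy_derivative]). *)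

(** The two branches of the enthalpy are the primitives of one power law: the
    logarithm is what replaces [rho^(gamma - 1) / (gamma - 1)] at [gamma = 1]. *)
Lemma enthalpy_derivative (gamma rho : R) :
  0 < rho ->
  is_derive (enthalpy gamma) rho (gamma * Rpower rho (gamma - 2)).
Proof.
intros Hrho; unfold enthalpy.
destruct (Req_EM_T gamma 1) as [-> | Hne].
- replace (1 * Rpower rho (1 - 2)) with (/ rho).
  + apply is_derive_Reals, derivable_pt_lim_ln; exact Hrho.
  + replace (1 - 2) with (- (1)) by ring.
    rewrite Rpower_Ropp, Rpower_1 by exact Hrho; ring.
- replace (gamma * Rpower rho (gamma - 2))
    with (gamma / (gamma - 1) * ((gamma - 1) * Rpower rho (gamma - 1 - 1))).
  + apply (is_derive_scal (fun r => Rpower r (gamma - 1))).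
    apply is_derive_Reals, derivable_pt_lim_power; exact Hrho.
  + replace (gamma - 1 - 1) with (gamma - 2) by ring.
    field; lra.
Qed.

Lemma Derive_enthalpy_pos (gamma rho : R) :
  0 < gamma -> 0 < rho -> 0 < Derive (enthalpy gamma) rho.
Proof.
intros Hgamma Hrho.
rewrite (is_derive_unique _ _ _ (enthalpy_derivative gamma rho Hrho)).
apply Rmult_lt_0_compat; [exact Hgamma | apply exp_pos].
Qed.

Lemma subsonic_or_sonic_sqr_le (gamma rho u : R) :
  0 < gamma -> 0 < rho ->
  subsonic gamma rho u \/ sonic gamma rho u ->
  u ^ 2 <= rho * Derive (enthalpy gamma) rho.
Proof.
intros Hgamma Hrho Hs.
assert (Hu : Rabs u <= sound_speed gamma rho)
  by (destruct Hs as [Hs | Hs]; unfold subsonic, sonic in Hs; lra).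
assert (Hc : 0 <= rho * Derive (enthalpy gamma) rho)
  by (apply Rlt_le, Rmult_lt_0_compat;
      [exact Hrho | exact (Derive_enthalpy_pos gamma rho Hgamma Hrho)]).
rewrite <- (pow2_abs u), <- (pow2_sqrt _ Hc).
apply pow_incr; split; [apply Rabs_pos | exact Hu].
Qed.

(** The substitution [lam = a + i (tau + xi (s - u))] completes the square
    [(lam - i xi (s - u))^2] and leaves [s] nowhere else. *)
Lemma dispersion_relation_split (gamma mu k s rho u xi : R) (lam : C) :
  dispersion_relation gamma mu k s rho u xi lam ->
  let a := Re lam in
  let tau := Im lam - xi * (s - u) in
  a ^ 2 - tau ^ 2 + mu * xi ^ 2 * a
    + rho * Derive (enthalpy gamma) rho * xi ^ 2 + k ^ 2 / 2 * xi ^ 4 = 0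
  /\ (2 * a + mu * xi ^ 2) * tau = mu * xi ^ 2 * (xi * u).
Proof.
unfold dispersion_relation; set (c2 := rho * _).
destruct lam as [a b]; intros H; simpl Re; simpl Im.
pose proof (f_equal Re H) as Hre; pose proof (f_equal Im H) as Him; clear H.
cbn -[pow] in Hre, Him.
split; lra.
Qed.

Lemma Re_neg_of_split_dispersion (mu k c2 u xi a tau : R) :
  0 < mu -> 0 < k -> u ^ 2 <= c2 -> xi <> 0 ->
  a ^ 2 - tau ^ 2 + mu * xi ^ 2 * a + c2 * xi ^ 2 + k ^ 2 / 2 * xi ^ 4 = 0 ->
  (2 * a + mu * xi ^ 2) * tau = mu * xi ^ 2 * (xi * u) ->
  a < 0.
Proof.
intros Hmu Hk Hu Hxi Hre Him.
destruct (Rlt_or_le a 0) as [Ha | Ha]; [exact Ha | exfalso].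
assert (Hxi2 : 0 < xi ^ 2) by (apply pow2_gt_0; exact Hxi).
assert (Hm : 0 < mu * xi ^ 2) by (apply Rmult_lt_0_compat; assumption).
set (m := mu * xi ^ 2) in *.
(* The damping [2 a] can only increase the factor in front of [tau]. *)
assert (Htau : tau ^ 2 <= (xi * u) ^ 2).
{ apply (Rmult_le_reg_l (m ^ 2)); [apply pow_lt; exact Hm |].
  replace (m ^ 2 * (xi * u) ^ 2) with ((m * (xi * u)) ^ 2) by ring.
  rewrite <- Him, Rpow_mult_distr.
  apply Rmult_le_compat_r; [apply pow2_ge_0 |].
  apply pow_incr; lra. }
assert (Hc : (xi * u) ^ 2 <= c2 * xi ^ 2).
{ rewrite Rpow_mult_distr, Rmult_comm.
  apply Rmult_le_compat_r; lra. }
assert (Hma : 0 <= m * a) by (apply Rmult_le_pos; lra).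
assert (Hk4 : 0 < k ^ 2 / 2 * xi ^ 4).
{ replace (k ^ 2 / 2 * xi ^ 4) with ((k * xi ^ 2) ^ 2 / 2) by field.
  assert (0 < (k * xi ^ 2) ^ 2)
    by (apply pow_lt, Rmult_lt_0_compat; assumption).
  lra. }
pose proof (pow2_ge_0 a).
lra.
Qed.

Theorem proposition2p2 (gamma mu k s : R)
  (Hgamma : 1 <= gamma) (Hmu : 0 < mu) (Hk : 0 < k)
  (Rho U : R -> R) (Rend Uend : side -> R)
  (HRend : forall e : side, 0 < Rend e)
  (Hprofile : traveling_wave_profile gamma mu k s Rho U Rend Uend) :
  forall e : side,
    subsonic gamma (Rend e) (Uend e) \/ sonic gamma (Rend e) (Uend e) ->
    forall (xi : R) (lam : C),
      dispersion_relation gamma mu k s (Rend e) (Uend e) xi lam ->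
      Re lam <= 0 /\ (xi <> 0 -> Re lam < 0).
Proof.
intros e Hs xi lam Hdisp.
assert (Hu := subsonic_or_sonic_sqr_le gamma (Rend e) (Uend e)
                ltac:(lra) (HRend e) Hs).
destruct (dispersion_relation_split _ _ _ _ _ _ _ _ Hdisp) as [Hre Him].
destruct (Req_dec xi 0) as [-> | Hxi].
- split; [| intros H; now elim H].
  (* Here [a^2 = tau^2] and [a tau = 0], which forces [a = 0]. *)
  set (a := Re lam) in *.
  set (tau := Im lam - _) in *.
  assert (H2 : a * tau = 0) by lra.
  destruct (Rmult_integral _ _ H2) as [H0 | H0]; [lra |].
  rewrite H0 in Hre.
  nra.
- assert (Ha := Re_neg_of_split_dispersion _ _ _ _ _ _ _
                  Hmu Hk Hu Hxi Hre Him).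
  split; [lra | intros _; exact Ha].
Qed.
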